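(* Let $n \in \mathbb{N}$ and $f \in \mathbb{N}_0$, and put $N = 2n+f$. Then the set $\mathcal{M}_{N,f}$ is Schur-positive with respect to the statistic $\mathrm{Short}$, and \[ \mathcal{Q}_{N,\mathrm{Short}}(\mathcal{M}_{N,f}) = \sum_{k=0}^{n} \bigl|\{ m \in \mathcal{M}_{N-2k,f} \mid \mathrm{Short}(m) = \emptyset\}\bigr| \, s_{(N-k,k)}. \]
   Context: For $N \ge 1$ and $J \subseteq [N-1]=\{1,\dots,N-1\}$, the fundamental quasisymmetric function is $F_{N,J} = \sum x_{i_1}x_{i_2}\cdots x_{i_N}$, the sum over all $i_1 \le i_2 \le \dots \le i_N$ (positive integers) with $i_j < i_{j+1}$ for every $j \in J$. For a finite set $\mathcal{A}$ and a map $D:\mathcal{A}\to 2^{[N-1]}$, put $\mathcal{Q}_{N,D}(\mathcal{A}) = \sum_{a\in\mathcal{A}} F_{N,D(a)}$. $\mathcal{A}$ is called symmetric with respect to $D$ if $\mathcal{Q}_{N,D}(\mathcal{A})$ is a symmetric function; it then has a unique expansion $\sum_{\lambda\vdash N} c_\lambda s_\lambda$ in Schur functions, and $\mathcal{A}$ is Schur-positive if moreover all $c_\lambda$ are nonnegative integers. A matching on a finite set $S\subseteq\mathbb{N}$ is a partition of $S$ into blocks of size 1 or 2; a block $\{i\}$ is an unmatched vertex, a block $\{i,j\}$ is a chord, written $(i,j)$. $\mathcal{M}_N$ is the set of matchings on $[N]$ and $\mathcal{M}_{N,f}$ the set of those with exactly $f$ unmatched vertices ($\mathcal{M}_{0,0}$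 consists of the empty matching). For $m\in\mathcal{M}_N$, $\mathrm{Short}(m) = \{ i \in [N-1] \mid (i,i+1) \text{ is a chord of } m\}$ (so the pair $(1,N)$ is never counted). *)

(* Defs.v *)
From mathcomp Require Import all_boot all_order all_algebra.
From mathcomp Require Import finmap multiset.

Set Implicit Arguments.
Unset Strict Implicit.
Unset Printing Implicit Defensive.

Local Open Scope mset_scope.
Local Open Scope nat_scope.

(* The sets {1, ..., N} and {1, ..., N-1} are 'I_N and 'I_N.-1, the ordinal of
   value i standing for the integer i + 1; likewise i : nat indexes the
   variable x_{i+1}. *)

(* Formal power series over rat in x_1, x_2, ...: the monomial
   x_{i_1} ... x_{i_N} is the multiset {i_1, ..., i_N}, and a series maps each
   monomial to its coefficient, so that equality of series is =1. *)
Definition series : Type := {mset nat} -> rat.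

(* The sum of x_{i_1} ... x_{i_N} over all the words i = (i_1, ..., i_N) that
   satisfy P: the words giving the monomial x are the distinct arrangements
   of the multiset x. *)
Definition word_series (P : pred (seq nat)) : series :=
  fun x => (count P (permutations x))%:R%R.

Definition series_sum (I : finType) (A : {pred I}) (g : I -> series) : series :=
  fun x => (\sum_(i in A) g i x)%R.

Definition series_scale (c : rat) (g : series) : series :=
  fun x => (c * g x)%R.

Definition rename_vars (sigma : nat -> nat) (x : {mset nat}) : {mset nat} :=
  seq_mset [seq sigma i | i <- x].

Definition symmetric_function (g : series) : Prop :=
  (exists d : nat, forall x : {mset nat}, g x != 0%R -> size x <= d) /\
  (forall sigma : nat -> nat, bijective sigma ->
     forall x : {mset nat}, g (rename_vars sigma x) = g x).

Definition fundamental (N : nat) (J : {set 'I_N.-1}) : series :=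
  word_series (fun i =>
    [&& size i == N, sorted leq i
      & [forall j in J, nth 0 i (val j) < nth 0 i (val j).+1]]).

Definition quasi_gen (N : nat) (T : finType) (D : T -> {set 'I_N.-1})
    (A : {set T}) : series :=
  series_sum A (fun a => fundamental (D a)).

(* T is the sequence of rows, from the longest to the shortest, so that zip
   pairs each entry of a row with the entry above it. *)
Definition semistandard (T : seq (seq nat)) : bool :=
  all (sorted leq) T &&
  sorted (fun r1 r2 => all (fun p => p.1 < p.2) (zip r1 r2)) T.

(* Tableaux of shape la are encoded by their rows, concatenated from top to
   bottom. The sequence la is a partition, possibly padded with zeros. *)
Definition schur (la : seq nat) : series :=
  word_series (fun w => (size w == sumn la) && semistandard (reshape la w)).

(* Partitions of N, padded with zeros to length N. *)
Definition is_partn (N : nat) (t : N.-tuple 'I_N.+1) : bool :=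
  let s := [seq val i | i <- t] in sorted geq s && (sumn s == N).

Definition partn (N : nat) : finType := {t : N.-tuple 'I_N.+1 | is_partn t}.

Definition parts (N : nat) (la : partn N) : seq nat :=
  [seq nat_of_ord i | i <- val la].

Definition symmetric_wrt (N : nat) (T : finType) (D : T -> {set 'I_N.-1})
    (A : {set T}) : Prop :=
  symmetric_function (quasi_gen D A).

Definition schur_positive (N : nat) (T : finType) (D : T -> {set 'I_N.-1})
    (A : {set T}) : Prop :=
  symmetric_wrt D A /\
  exists c : partn N -> rat,
    quasi_gen D A =1
      series_sum predT (fun la => series_scale (c la) (schur (parts la))) /\
    forall la, c la \is a Num.nat.

Definition matchings (N : nat) : {set {set {set 'I_N}}} :=
  [set m | partition m [set: 'I_N]
         & [forall B in m, (#|B| == 1) || (#|B| == 2)]].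

Definition unmatched (N : nat) (m : {set {set 'I_N}}) : {set {set 'I_N}} :=
  [set B in m | #|B| == 1].

Definition matchings_f (N f : nat) : {set {set {set 'I_N}}} :=
  [set m in matchings N | #|unmatched m| == f].

Definition Short (N : nat) (m : {set {set 'I_N}}) : {set 'I_N.-1} :=
  [set i : 'I_N.-1 | [exists u : 'I_N, exists v : 'I_N,
     [&& val u == val i, val v == (val i).+1 & [set u; v] \in m]]].

(* Main.v *)
(* Let s be the sorted word of a monomial of degree N, and let R be the set of
   positions where s has two equal adjacent letters. The coefficient of the
   monomial in Q is the number of matchings without short chord at a position
   of R, and its coefficient in s_(N-k,k) is the number of ballot words with k
   letters "second row" that never step from the first row to the second at a
   position of R (standardization). Lifting the restriction at the last
   position t of R adds the objects that do have a short chord (a step) at t;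
   deleting it leaves an object of size N - 2, restricted only at the positions
   of R before t - 1. Hence both sides of the identity satisfy the same
   recursion in R, and they only have to be compared when every position is
   restricted: there the matchings are those with no short chord at all, and
   the only ballot word is the constant one.

   The same recursion, applied to all words instead of ballot words, gives
   s_(N-k,k) = h_(N-k) h_k - h_(N-k+1) h_(k-1) coefficientwise, hence the
   symmetry of s_(N-k,k). *)
Require Import Defs.
From mathcomp Require Import all_boot all_order all_algebra.
From mathcomp Require Import finmap multiset.
From mathcomp Require Import zify.

Set Implicit Arguments.
Unset Strict Implicit.
Unset Printing Implicit Defensive.

(** * Counting functions determined by a deletion recursion *)

Definition below (t : nat) (R : pred nat) : pred nat := fun i => (i < t) && R i.

(* F j R counts objects of size 2j + e restricted at the positions in R, so
   that j drops by one when a pair of adjacent points is deleted. *)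
Definition deletion_recursive (e : nat) (F : nat -> pred nat -> nat) : Prop :=
  [/\ forall R, F 0 R = F 0 predT,
      forall j R R', (forall i, i.+1 < j.*2 + e -> R i = R' i) -> F j R = F j R'
    & forall j t (R : pred nat), R t -> t.+1 < (j.*2 + e).+2 ->
        F j.+1 (below t R) = F j.+1 (below t.+1 R) + F j (below t.-1 R)].

(** Induction on j. For fixed j, raising t from 0 to the full length changes F and G by equal
    amounts, so their difference at [below t S] does not depend on t. Taking S = [predT] shows that
    F and G agree with no restriction, and then S = R carries this to R. *)
Lemma deletion_recursive_eq (e : nat) (F G : nat -> pred nat -> nat) :
  deletion_recursive e F -> deletion_recursive e G ->
  (forall j, F j predT = G j predT) -> forall j R, F j R = G j R.
Proof.
move=> [F0 Fl Fd] [G0 Gl Gd] FG; elim=> [|j IH] R; first by rewrite F0 FG G0.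
have below0 S : below 0 S =1 pred0 by [].
(* The constancy of the difference, written additively to avoid truncated subtraction. *)
have step (S : pred nat) t : t <= (j.*2 + e).+1 ->
    F j.+1 (below t S) + G j.+1 pred0 = G j.+1 (below t S) + F j.+1 pred0.
  elim: t => [|t IHt] le_t.
    by rewrite (Fl _ _ _ (fun i _ => below0 S i)) (Gl _ _ _ (fun i _ => below0 S i)) addnC.
  move: (IHt (ltnW le_t)); case St: (S t).
    rewrite Fd // Gd // IH.
    by move=> E; apply/eqP; rewrite -(eqn_add2r (G j (below t.-1 S))) addnAC E addnAC.
  have bS i : below t.+1 S i = below t S i.
    by rewrite /below ltnS leq_eqVlt; case: eqVneq => [->|//]; rewrite St !andbF.
  by rewrite (Fl _ _ _ (fun i _ => bS i)) (Gl _ _ _ (fun i _ => bS i)).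
have full S : (F j.+1 (below (j.*2 + e).+1 S) = F j.+1 S) *
              (G j.+1 (below (j.*2 + e).+1 S) = G j.+1 S).
  by split; [apply: Fl | apply: Gl] => i; rewrite doubleS !addSn ltnS /below => ->.
move: (step predT _ (leqnn _)) (step R _ (leqnn _)).
by rewrite !full (FG j.+1) => /addnI -> /eqP; rewrite eqn_add2r => /eqP.
Qed.

(** * Two-row tableaux as words of row indices *)

(* The letter true stands for the second row, false for the first. *)
Definition rise_free (R : pred nat) (u : bitseq) : bool :=
  all (fun i => R i ==> (nth false u i.+1 ==> nth false u i)) (iota 0 (size u)).

Lemma rise_freeP (R : pred nat) (u : bitseq) :
  reflect (forall i, R i -> nth false u i.+1 -> nth false u i) (rise_free R u).
Proof.
apply: (iffP allP) => [free i Ri ui1|free i _]; last first.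
  by apply/implyP=> Ri; apply/implyP; apply: free.
have lt_i : i < size u.
  by rewrite ltnNge; apply: contraL ui1 => /leqW le_u; rewrite nth_default.
by move: (free i); rewrite mem_iota lt_i Ri ui1 => /(_ isT).
Qed.

(** Used with [beta] equal to [ballot 0] for tableaux and to [predT] for pairs of rows without
    column condition. *)
Definition words (beta : pred bitseq) (N k : nat) (R : pred nat) : {set N.-tuple bool} :=
  [set u : N.-tuple bool | [&& beta u, count id u == k & rise_free R u]].

Definition insert_rise (t : nat) (v : bitseq) : bitseq :=
  take t v ++ [:: false, true & drop t v].

Lemma size_insert_rise t v : size (insert_rise t v) = (size v).+2.
Proof. by rewrite /insert_rise size_cat /= !addnS -size_cat cat_take_drop. Qed.

Lemma count_insert_rise t v : count id (insert_rise t v) = (count id v).+1.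
Proof. by rewrite /insert_rise count_cat /= add0n addnCA -count_cat cat_take_drop. Qed.

Lemma nth_insert_rise t v i : t <= size v ->
  nth false (insert_rise t v) i =
    if i < t then nth false v i else if i < t.+2 then i == t.+1 else nth false v i.-2.
Proof.
move=> le_t; rewrite /insert_rise nth_cat size_takel //.
case: ltnP => [lt_it|le_ti]; first by rewrite nth_take.
move: (subnKC le_ti); case: (i - t) => [|[|d]] <-.
- by rewrite addn0 ltnS leqnSn /= ltn_eqF.
- by rewrite addn1 ltnS leqnn /= eqxx.
by rewrite /= !addnS !ltnS ltnNge leq_addr /= nth_drop.
Qed.

Lemma insert_rise_tupleP N t (v : N.-tuple bool) : size (insert_rise t v) == N.+2.
Proof. by rewrite size_insert_rise size_tuple. Qed.
Definition insert_rise_tuple N t (v : N.-tuple bool) : N.+2.-tuple bool :=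
  Tuple (insert_rise_tupleP t v).

(** The new rise sits at t, outside [below t], and no rise occurs at t - 1 because the letter at t
    is [false]. Only the positions i with i + 1 < t still constrain v. *)
Lemma rise_free_insert (R : pred nat) t v : t <= size v ->
  rise_free (below t R) (insert_rise t v) = rise_free (below t.-1 R) v.
Proof.
move=> le_t; apply/rise_freeP/rise_freeP => free i /andP[lt_it Ri] ui.
  have [lt_i lt_i1] : i < t /\ i.+1 < t by lia.
  have /free : below t R i by rewrite /below lt_i.
  by rewrite !nth_insert_rise // lt_i lt_i1; apply.
move: ui; rewrite !nth_insert_rise // lt_it; case: ltnP => [lt_i1|le_t1].
  by apply: free; rewrite /below Ri; lia.
by rewrite ltnS (leq_trans lt_it) //= eqSS ltn_eqF.
Qed.

(** The words allowed by [below t R] but not by [below t.+1 R] are those with a rise at t, and these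
    are exactly the images of [insert_rise t]. *)
Lemma card_words_deletion (beta : pred bitseq) N k t (R : pred nat) :
  (forall v, beta (insert_rise t v) = beta v) -> R t -> t.+1 < N.+2 ->
  #|words beta N.+2 k.+1 (below t R)| =
    #|words beta N.+2 k.+1 (below t.+1 R)| + #|words beta N k (below t.-1 R)|.
Proof.
move=> betaE Rt; rewrite !ltnS => le_tN.
have inj : injective (@insert_rise_tuple N t).
  move=> v w /(congr1 val) /= E; apply: val_inj; apply: (@eq_from_nth _ false).
    by rewrite !size_tuple.
  (* Letter i of v is read in the longer word at an index that jumps over the inserted pair. *)
  move=> i _; have := congr1 (nth false ^~ (if i < t then i else i.+2)) E.
  rewrite !nth_insert_rise ?size_tuple //; case: (ltnP i t) => [-> //|le_ti].
  by rewrite !ltnS !ltnNge le_ti (leqW (leqW le_ti)).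
rewrite -(card_imset _ inj) -[LHS](cardsID (words beta N.+2 k.+1 (below t.+1 R))).
congr (_ + _); apply: eq_card => u; rewrite !inE.
  apply: andb_idl => /and3P[-> -> /rise_freeP free] /=.
  by apply/rise_freeP => i /andP[lt_i Ri]; apply: free; rewrite /below Ri ltnW // ltnS ltnW.
apply/idP/imsetP => [/andP[nu /and3P[bu cu fu]]|[v vW ->]].
  have [ut ut1] : nth false u t = false /\ nth false u t.+1.
    move: nu; rewrite bu cu /= => /negP nfree.
    suff : ~~ (nth false u t.+1 ==> nth false u t) by case: (nth _ _ t) (nth _ _ t.+1) => [] [].
    apply/negP => /implyP ut; apply: nfree.
    apply/rise_freeP => i /andP[]; rewrite ltnS leq_eqVlt.
    case: eqVneq => [-> _ _|_ /= lt_it Ri]; first exact: ut.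
    by apply: (rise_freeP _ _ fu); rewrite /below lt_it.
  pose w := take t u ++ drop t.+2 u.
  have tu : t.+1 < size u by rewrite size_tuple.
  have uE : insert_rise t w = u.
    have st : size (take t u) = t by rewrite size_takel // ltnW // ltnW.
    rewrite /insert_rise /w take_size_cat // drop_size_cat // -[RHS](cat_take_drop t).
    by rewrite [in RHS](drop_nth false) ?(drop_nth false (n := t.+1)) ?ut ?ut1 // ltnW.
  have sw : size w == N by rewrite -2!eqSS -(size_insert_rise t) uE size_tuple.
  exists (Tuple sw); last exact: val_inj.
  move: bu cu fu; rewrite inE /= -uE betaE count_insert_rise eqSS rise_free_insert ?(eqP sw) //.
  by move=> -> ->.
move: vW; rewrite inE /= betaE count_insert_rise eqSS => /and3P[-> -> fv].
rewrite rise_free_insert ?size_tuple ?fv //= andbT; apply/negP => /rise_freeP/(_ t).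
by rewrite /below ltnS leqnn Rt !nth_insert_rise ?size_tuple // ltnn ltnS leqnn !ltnS leqnSn
   eqxx ltn_eqF // ltnNge leqnSn => /(_ isT isT).
Qed.
Lemma eq_words beta N k (R R' : pred nat) :
  (forall i, i.+1 < N -> R i = R' i) -> words beta N k R = words beta N k R'.
Proof.
move=> eqR; apply/setP=> u; rewrite !inE; congr [&& _, _ & _].
have lt_i i : nth false u i.+1 -> i.+1 < N.
  by move=> ui; rewrite ltnNge; apply: contraL ui => le_u; rewrite nth_default ?size_tuple.
by apply/rise_freeP/rise_freeP => free i Ri ui; apply: free => //; move: Ri; rewrite eqR ?lt_i.
Qed.

Lemma words0 beta N (R : pred nat) : words beta N 0 R = words beta N 0 predT.
Proof.
apply/setP=> u; rewrite !inE; case: (beta u) => //=; case: eqP => //= cu.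
have u0 i : nth false u i = false.
  have [lt_i|le_u] := ltnP i (size u); last by rewrite nth_default.
  apply/negbTE/negP => ui; have: has id u by apply/hasP; exists (nth false u i); rewrite ?mem_nth.
  by rewrite has_count cu.
by apply/rise_freeP/rise_freeP => _ i _; rewrite u0.
Qed.

(** Deleting a rise lowers both j and the number of second-row letters by one, so their difference d
    is invariant. The guard prevents truncated subtraction from counting words when d > j. *)
Definition shifted_words beta e d j R : nat :=
  if d <= j then #|words beta (j.*2 + e) (j - d) R| else 0.

Lemma shifted_words_recursive (beta : pred bitseq) e d :
  (forall t v, beta (insert_rise t v) = beta v) ->
  deletion_recursive e (shifted_words beta e d).
Proof.
move=> betaE; split=> [R|j R R' eqR|j t R Rt lt_t]; rewrite /shifted_words.
- by rewrite sub0n words0.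
- by rewrite (eq_words _ _ eqR).
(* In the boundary case d = j + 1 there are no second-row letters, hence no rises: R is irrelevant
   and the deletion term is 0. *)
rewrite doubleS !addSn; case: (ltngtP d j.+1) => [|lt_jd|->].
- by rewrite ltnS => le_dj; rewrite le_dj subSn // card_words_deletion.
- by rewrite leqNgt (ltnW lt_jd).
by rewrite ltnn subnn addn0 words0 [in RHS]words0.
Qed.

Lemma deletion_recursiveD e (F G : nat -> pred nat -> nat) :
  deletion_recursive e F -> deletion_recursive e G ->
  deletion_recursive e (fun j R => F j R + G j R).
Proof.
move=> [F0 Fl Fd] [G0 Gl Gd]; split=> [R|j R R' eqR|j t R Rt lt_t].
- by rewrite F0 G0.
- by rewrite (Fl _ _ _ eqR) (Gl _ _ _ eqR).
by rewrite Fd // Gd // addnACA.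
Qed.

(** Here h is the surplus of first-row letters over second-row letters read so far. *)
Fixpoint ballot (h : nat) (u : bitseq) : bool :=
  if u is b :: u' then
    if b then (0 < h) && ballot h.-1 u' else ballot h.+1 u'
  else true.

Lemma ballot_insert_rise h t v : ballot h (insert_rise t v) = ballot h v.
Proof.
elim: v t h => [|b v IH] [|t] h //=.
by rewrite -/(insert_rise t v); case: b; rewrite IH.
Qed.

Lemma rise_free_predT u : rise_free predT u ->
  u = nseq (count id u) true ++ nseq (size u - count id u) false.
Proof.
elim: u => [|b u IH] //= /rise_freeP free.
have /IH {IH} uE : rise_free predT u by apply/rise_freeP=> i _; apply: (free i.+1).
case: b free => free /=; first by rewrite add1n subSS -uE.
have c0 : count id u = 0.
  by case: (count id u) uE => // c uE; have := free 0 isT; rewrite uE => /(_ isT).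
by rewrite add0n c0 subn0 /= {1}uE c0 subn0.
Qed.

Lemma card_words_predT N k : k <= N -> #|words predT N k predT| = 1.
Proof.
move=> le_kN; have sz : size (nseq k true ++ nseq (N - k) false) == N.
  by rewrite size_cat !size_nseq subnKC.
apply/eqP/cards1P; exists (Tuple sz); apply/setP=> u; rewrite !inE /=.
apply/andP/eqP => [[/eqP cu /rise_free_predT uE]|->].
  by apply: val_inj; rewrite /= uE cu size_tuple.
split; first by rewrite /= count_cat !count_nseq mul1n mul0n addn0.
apply/rise_freeP=> i _; rewrite /= !nth_cat !size_nseq !nth_nseq.
by case: ltnP => [/ltnW ->|]; rewrite ?if_same //; case: (i < k) => //; case: ifP.
Qed.

(** Without rises all second-row letters come first, which breaks the ballot condition unless there
    are none. *)
Lemma card_words_ballot_predT N k : #|words (ballot 0) N k predT| = (k == 0).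
Proof.
case: k => [|k].
  rewrite -[RHS](@card_words_predT N 0) //; apply: eq_card => u; rewrite !inE /=.
  apply: andb_idl => /andP[/eqP cu /rise_free_predT ->]; rewrite cu /=.
  by move: (_ - 0) => m; elim: m {u cu} 0 => //=.
apply: eq_card0 => u; rewrite !inE; apply/negP => /and3P[bu /eqP cu /rise_free_predT uE].
by move: bu; rewrite uE cu.
Qed.

(* Jacobi-Trudi for two rows, in terms of words. *)
Lemma card_words_ballot e j R :
  shifted_words (ballot 0) e 0 j R + shifted_words predT e 1 j R =
    shifted_words predT e 0 j R.
Proof.
apply: (@deletion_recursive_eq e (fun j R => shifted_words (ballot 0) e 0 j R +
    shifted_words predT e 1 j R)) => [||{}j].
- by apply: deletion_recursiveD; apply: shifted_words_recursive => // t v;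
    apply: ballot_insert_rise.
- exact: shifted_words_recursive.
(* With every position restricted the identity reads 1 + 0 = 1 for j = 0 and 0 + 1 = 1 for j > 0. *)
rewrite /shifted_words subn0 /= card_words_ballot_predT !card_words_predT; try lia.
by case: j => //= j; rewrite card_words_predT //; lia.
Qed.

(** * Standardization of two-row fillings *)

(* Equal letters are ordered with those of the second row first, as in the
   standardization of a semistandard tableau. *)
Definition tag_le : rel (nat * bool) :=
  fun a b => (a.1 < b.1) || ((a.1 == b.1) && (b.2 ==> a.2)).

Lemma tag_le_trans : transitive tag_le.
Proof.
move=> [b b'] [a a'] [c c'] /orP[/= ab|/andP[/= /eqP-> ab]] /orP[/= bc|/andP[/= /eqP<- bc]].
- by rewrite /tag_le /= (ltn_trans ab bc).
- by rewrite /tag_le /= ab.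
- by rewrite /tag_le /= bc.
by rewrite /tag_le /= eqxx ltnn; case: a' b' c' ab bc => [] [] [].
Qed.

Lemma tag_le_total : total tag_le.
Proof.
by move=> [a a'] [b b']; rewrite /tag_le /=; case: ltngtP => //= _; case: a' b' => [] [].
Qed.

Lemma tag_le_anti : antisymmetric tag_le.
Proof.
move=> [a a'] [b b']; rewrite /tag_le /=; case: ltngtP => //= ->.
by case: a' b' => [] [].
Qed.

Definition ties (s : seq nat) : pred nat := fun i => nth 0 s i == nth 0 s i.+1.

(** Where s has a tie, [tag_le] forbids exactly a rise of u; where s increases strictly, it leaves u
    free. *)
Lemma sorted_zip_tag_le s u : size u = size s ->
  sorted tag_le (zip s u) = sorted leq s && rise_free (ties s) u.
Proof.
move=> szu; have szz : size (zip s u) = size s by rewrite size_zip szu minnn.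
have E i : i.+1 < size s ->
    tag_le (nth (0, false) (zip s u) i) (nth (0, false) (zip s u) i.+1) =
    (nth 0 s i <= nth 0 s i.+1) && (ties s i ==> (nth false u i.+1 ==> nth false u i)).
  by move=> _; rewrite !nth_zip // /tag_le /ties /=; case: ltngtP.
apply/(sortedP (0, false))/andP=> [srt|[/(sortedP 0) srt /rise_freeP free] i lt_i].
  rewrite szz in srt; split; first by apply/(sortedP 0) => i lt_i; move: (srt i lt_i); rewrite E // => /andP[].
  apply/rise_freeP => i ti ui; have lt_i : i.+1 < size s.
    by rewrite -szu ltnNge; apply: contraL ui => le_u; rewrite nth_default.
  by move: (srt i lt_i); rewrite E // ti ui => /andP[_].
rewrite szz in lt_i; rewrite E // srt //=; by apply/implyP => ti; apply/implyP; apply: free.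
Qed.

Definition row1 (t : seq (nat * bool)) : seq nat := [seq p.1 | p <- t & ~~ p.2].
Definition row2 (t : seq (nat * bool)) : seq nat := [seq p.1 | p <- t & p.2].
Definition rows (t : seq (nat * bool)) : seq nat := row1 t ++ row2 t.
Definition tagged_rows (a : nat) (w : seq nat) : seq (nat * bool) :=
  [seq (v, false) | v <- take a w] ++ [seq (v, true) | v <- drop a w].

Lemma size_row2 t : size (row2 t) = count id (unzip2 t).
Proof. by rewrite size_map size_filter count_map. Qed.

Lemma size_rows t : size (row1 t) + size (row2 t) = size t.
Proof. by rewrite !size_map !size_filter addnC count_predC. Qed.

Lemma perm_tagged_rows t : perm_eq (tagged_rows (size (row1 t)) (rows t)) t.
Proof.
rewrite /tagged_rows take_size_cat // drop_size_cat //.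
have -> : [seq (v, false) | v <- row1 t] = [seq p <- t | ~~ p.2].
  by rewrite /row1; elim: t => //= -[v []] t //= ->.
have -> : [seq (v, true) | v <- row2 t] = [seq p <- t | p.2].
  by rewrite /row2; elim: t => //= -[v []] t //= ->.
by rewrite perm_catC (perm_filterC snd t).
Qed.

Lemma perm_rows t : perm_eq (rows t) (unzip1 t).
Proof. by rewrite /rows -map_cat perm_map // perm_catC (perm_filterC snd t). Qed.

Lemma sorted_row (p : pred (nat * bool)) t :
  sorted tag_le t -> sorted leq [seq q.1 | q <- t & p q].
Proof.
move=> st; apply: (@homo_sorted _ _ _ tag_le) => [a b /orP[/ltnW//|/andP[/eqP->]]//|].
exact: (sorted_filter tag_le_trans).
Qed.

Lemma sort_tagged_rows t : sorted tag_le t ->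
  sort tag_le (tagged_rows (size (row1 t)) (rows t)) = t.
Proof.
move=> st; rewrite -[RHS](sorted_sort tag_le_trans st).
by apply/(perm_sortP tag_le_total tag_le_trans tag_le_anti); apply: perm_tagged_rows.
Qed.

(** Stable filtering commutes with sorting, and each row is already sorted, so sorting the tagged
    entries leaves both rows intact. *)
Lemma rows_sort_tagged a w : sorted leq (take a w) -> sorted leq (drop a w) ->
  rows (sort tag_le (tagged_rows a w)) = w.
Proof.
move=> s1 s2; have tag_sorted b r : sorted leq r -> sorted tag_le [seq (v, b) | v <- r].
  by apply: homo_sorted => v v'; rewrite leq_eqVlt /tag_le /= implybb andbT orbC.
rewrite /rows /row1 /row2 !(filter_sort tag_le_total tag_le_trans) /tagged_rows !filter_cat.
rewrite !filter_map /= !filter_predT !filter_pred0 /= cats0.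
rewrite !(sorted_sort tag_le_trans) ?tag_sorted // -!map_comp !map_id; exact: cat_take_drop.
Qed.

(** The bijection sends u to [rows (zip s u)], where u tells the row of each letter of s. Its
    inverse tags the entries of w with their rows, sorts them by [tag_le] and keeps the tags.
    Leaving Q and [beta] abstract covers both tableaux and unconstrained pairs of rows. *)
Lemma count_two_rows (beta : pred bitseq) (Q : pred (seq nat)) N k x :
  size x = N -> k <= N ->
  (forall t, sorted tag_le t -> size t = N -> count id (unzip2 t) = k ->
     Q (rows t) = beta (unzip2 t)) ->
  count (fun w => [&& sorted leq (take (N - k) w), sorted leq (drop (N - k) w) & Q w])
    (permutations x) = #|words beta N k (ties (sort leq x))|.
Proof.
move=> szx le_kN QE; set s := sort leq x.
have szs : size s = N by rewrite size_sort.
have size1 (t : seq (nat * bool)) : size t = N -> count id (unzip2 t) = k -> size (row1 t) = N - k.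
  by move=> szt ct; rewrite -szt -size_rows size_row2 ct addnK.
have words_zip (u : N.-tuple bool) : u \in words beta N k (ties s) ->
    [/\ sorted tag_le (zip s u), size (zip s u) = N, count id (unzip2 (zip s u)) = k,
        unzip2 (zip s u) = u & unzip1 (zip s u) = s].
  rewrite inE => /and3P[_ /eqP cu fu].
  by rewrite sorted_zip_tag_le ?size_zip ?unzip2_zip ?unzip1_zip ?size_tuple ?szs ?minnn //
     fu andbT sort_sorted //; apply: leq_total.
rewrite -size_filter cardE -(size_map (fun u : N.-tuple bool => rows (zip s u))).
apply/perm_size/uniq_perm.
- by rewrite filter_uniq ?permutations_uniq.
- rewrite map_inj_in_uniq ?enum_uniq // => u v; rewrite !mem_enum => uW vW E.
  have [su szu cu uE _] := words_zip _ uW; have [sv szv cv vE _] := words_zip _ vW.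
  apply: val_inj; rewrite /= -uE -vE -(sort_tagged_rows su) -(sort_tagged_rows sv) E.
  by rewrite !size1.
move=> w; rewrite mem_filter mem_permutations; apply/idP/mapP.
  case/andP=> /and3P[s1 s2 Qw] pw; pose t := sort tag_le (tagged_rows (N - k) w).
  have st : sorted tag_le t by apply: sort_sorted; apply: tag_le_total.
  have wE : rows t = w by apply: rows_sort_tagged.
  have szw : size w = N by rewrite (perm_size pw).
  have szt : size t = N by rewrite size_sort size_cat !size_map -size_cat cat_take_drop.
  (* Both are sorted arrangements of x. *)
  have tE : unzip1 t = s.
    have srt : sorted leq (unzip1 t) by move: (sorted_row predT st); rewrite filter_predT.
    rewrite -(sorted_sort leq_trans srt).
    apply/(perm_sortP leq_total leq_trans anti_leq); apply: perm_trans pw.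
    by rewrite -wE perm_sym perm_rows.
  have ct : count id (unzip2 t) = k.
    rewrite count_map /t count_sort count_cat !count_map.
    rewrite (eq_count (a2 := pred0)) // count_pred0 (eq_count (a2 := predT)) // count_predT.
    by rewrite size_drop szw subKn.
  have szu : size (unzip2 t) == N by rewrite size_map szt.
  have zE : zip s (Tuple szu) = t by rewrite -tE /= zip_unzip.
  exists (Tuple szu); last by rewrite zE.
  rewrite mem_enum inE /= ct eqxx -QE // wE Qw.
  have : sorted tag_le (zip s (Tuple szu)) by rewrite zE.
  by rewrite sorted_zip_tag_le ?size_tuple // => /andP[].
case=> u; rewrite mem_enum => uW ->; have [su szu cu uE sE] := words_zip _ uW.
have s1 := size1 _ szu cu.
rewrite {1 2}/rows -s1 take_size_cat // drop_size_cat // !sorted_row //= QE // uE.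
move: uW; rewrite inE => /andP[-> _] /=.
by rewrite (perm_trans (perm_rows _)) // sE perm_sort.
Qed.

(* r is the part of the first row that has been read and not yet been paired
   with an entry of the second row. *)
Lemma ballot_columns t r : sorted tag_le ([seq (v, false) | v <- r] ++ t) ->
  all (fun p => p.1 < p.2) (zip (r ++ row1 t) (row2 t)) &&
    (size (row2 t) <= size r + size (row1 t)) = ballot (size r) (unzip2 t).
Proof.
elim: t r => [|[v b] t IH] r srt /=; first by rewrite /row1 /row2 /=; case: (_ ++ _).
rewrite /row1 /row2; case: b srt => /=; rewrite -/(row1 t) -/(row2 t) => srt; last first.
  by rewrite -cat_rcons addnS -addSn -(size_rcons r v) IH // map_rcons cat_rcons.
case: r srt => [|p r] /= srt.
  (* No first-row entry is pending, so v would lie below some later q, which is at least v; if there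
     is no such q, the size condition fails. The ballot condition fails as well. *)
  case E: (row1 t) => [|q q1]; rewrite ?andbF //=.
  have /mapP[p pt ->] : q \in row1 t by rewrite E mem_head.
  have le_vp : v <= p.1.
    have /allP/(_ p) : all (tag_le (v, true)) t := order_path_min tag_le_trans srt.
    rewrite /tag_le /= => /(_ _)/orP[|/ltnW|/andP[/eqP<-]] //.
    by move: pt; rewrite mem_filter => /andP[].
  by rewrite ltnNge le_vp.
(* Equality is excluded because on a tie the second-row letter would precede p. *)
have -> : p < v.
  have : tag_le (p, false) (v, true).
    by apply: (allP (order_path_min tag_le_trans srt)); rewrite mem_cat mem_head orbT.
  by rewrite /tag_le /= andbF orbF.
rewrite !addSn ltnS IH //; apply: (subseq_sorted tag_le_trans _ (path_sorted srt)).
by apply: cat_subseq => //; apply: subseq_cons.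
Qed.

Lemma semistandard_two_row N k w : k.*2 <= N -> size w = N ->
  semistandard (reshape [:: N - k; k] w) =
    [&& sorted leq (take (N - k) w), sorted leq (drop (N - k) w)
      & all (fun p => p.1 < p.2) (zip (take (N - k) w) (drop (N - k) w))].
Proof.
move=> le_kN szw; have szd : size (drop (N - k) w) <= k by rewrite size_drop szw; lia.
rewrite /semistandard /= (take_oversize szd).
by rewrite !andbT andbA.
Qed.

(** Starting [ballot_columns] with no pending entry turns column strictness into the ballot
    condition; the comparison of row lengths there holds since 2k is at most N. *)
Lemma schur_two_row N k (x : {mset nat}%mset) : k.*2 <= N -> size x = N ->
  schur [:: N - k; k] x = (#|words (ballot 0) N k (ties (sort leq x))|%:R)%R.
Proof.
move=> le_kN szx; rewrite /schur /word_series; congr (_%:R)%R.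
have le_k : k <= N by lia.
pose Q w := all (fun p => p.1 < p.2) (zip (take (N - k) w) (drop (N - k) w)).
rewrite -(@count_two_rows _ Q N k x) // => [|t st szt ct].
  apply: eq_in_count => w; rewrite mem_permutations => /perm_size szw.
  by rewrite /= szw szx addn0 subnK // eqxx semistandard_two_row // szw.
have szr : size (row1 t) = N - k by rewrite -szt -size_rows size_row2 ct addnK.
rewrite /Q /rows -szr take_size_cat // drop_size_cat // -(@ballot_columns t [::]) //=.
by rewrite size_row2 ct add0n szr leq_subRL // addnn le_kN andbT.
Qed.

Lemma schur_degree la (x : {mset nat}%mset) : size x != sumn la -> schur la x = 0%R.
Proof.
move=> szx; rewrite /schur /word_series (eq_in_count (a2 := pred0)) ?count_pred0 // => w.
by rewrite mem_permutations => /perm_size ->; rewrite (negbTE szx).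
Qed.
(** * Deleting a short chord *)

Definition avoiding N f (R : pred nat) : {set {set {set 'I_N}}} :=
  [set m in matchings_f N f | [forall i in Short m, ~~ R i]].

Lemma avoidP N (R : pred nat) (m : {set {set 'I_N}}) :
  reflect (forall u v : 'I_N, v = u.+1 :> nat -> [set u; v] \in m -> ~~ R u)
          [forall i in Short m, ~~ R i].
Proof.
apply: (iffP forall_inP) => [av u v uv uvm|av i].
  have lt_u : u < N.-1 by move: (ltn_ord v) uv => /=; lia.
  apply: (av (Ordinal lt_u)); rewrite inE; apply/existsP; exists u; apply/existsP; exists v.
  by rewrite /= uv !eqxx.
rewrite inE => /existsP[u /existsP[v /and3P[/eqP ui /eqP vi uvm]]].
by rewrite -ui; apply: av uvm; move: ui vi => /= ->.
Qed.

Section InsertChord.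

Variables (N t : nat) (le_tN : t <= N).

Definition skip (i : 'I_N) : 'I_N.+2 := inord (if i < t then i : nat else i.+2).
(** The hypothesis [le_tN] keeps both endpoints in range, so that [inord] never takes its default
    value. *)
Definition chord : {set 'I_N.+2} := [set inord t; inord t.+1].
Definition insert_chord (m : {set {set 'I_N}}) : {set {set 'I_N.+2}} :=
  chord |: [set skip @: (B : {set 'I_N}) | B in m].

Lemma val_skip i : skip i = (if i < t then i : nat else i.+2) :> nat.
Proof. by rewrite inordK //; have := ltn_ord i; case: ifP; lia. Qed.

Lemma skip_inj : injective skip.
Proof.
move=> i j /(congr1 val); rewrite /= !val_skip => E; apply: val_inj => /=.
by move: E; case: ltnP => ?; case: ltnP => ?; lia.
Qed.

Lemma in_chord (i : 'I_N.+2) : (i \in chord) = (i == t :> nat) || (i == t.+1 :> nat).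
Proof. by rewrite !inE -!val_eqE /= !inordK // ltnS leqW. Qed.

Lemma skip_setT : skip @: setT = ~: chord.
Proof.
apply/setP=> i; rewrite inE in_chord; apply/imsetP/idP => [[j _ ->]|].
  by rewrite val_skip; case: ltnP; lia.
move=> ni; have lt_j : (if i < t then i : nat else i.-2) < N.
  by have := ltn_ord i; case: (ltnP i t); lia.
exists (Ordinal lt_j) => //; apply: val_inj; rewrite /= val_skip /=.
by case: (ltnP i t) => [-> //|le_ti]; case: ltnP; lia.
Qed.

Lemma skip_notin_chord i : skip i \notin chord.
Proof. by rewrite -in_setC -skip_setT imset_f. Qed.

Lemma card_chord : #|chord| = 2.
Proof. by rewrite cards2 -val_eqE /= !inordK ?ltnS ?leqW // ltn_eqF. Qed.

Lemma chord_notin_skip (m : {set {set 'I_N}}) : chord \notin [set skip @: (B : {set 'I_N}) | B in m].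
Proof.
apply/imsetP=> -[B _ E]; have : inord t \in chord by rewrite !inE eqxx.
by rewrite {1}E => /imsetP[i _ ti]; move: (skip_notin_chord i); rewrite -ti !inE eqxx.
Qed.

Lemma insert_chord_inj : injective insert_chord.
Proof.
move=> m m' E; apply: (imset_inj (imset_inj skip_inj)).
by rewrite -(setU1K (chord_notin_skip m)) -(setU1K (chord_notin_skip m')) -/(insert_chord m) E.
Qed.

(** The image of [skip] is the complement of [chord], so an injective image of a partition of the N
    points is completed by the one block [chord]. *)
Lemma insert_chord_matchings m : (insert_chord m \in matchings N.+2) = (m \in matchings N).
Proof.
rewrite !inE; congr (_ && _).
  rewrite -(imset_partition _ _ skip_inj) skip_setT.
  apply/idP/idP => [/partitionD1/(_ (setU11 _ _))|part].
    by rewrite setU1K ?chord_notin_skip // setTD.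
  rewrite -(setUCr chord) partitionU1 // -?card_gt0 ?card_chord //.
  by rewrite -setI_eq0 setICr.
apply/forall_inP/forall_inP => [szs B mB|szs B /setU1P[->|/imsetP[C mC ->]]].
- by rewrite -(card_imset _ skip_inj); apply: szs; rewrite inE orbC imset_f.
- by rewrite card_chord.
by rewrite card_imset ?szs //; apply: skip_inj.
Qed.

Lemma card_unmatched_insert m : #|unmatched (insert_chord m)| = #|unmatched m|.
Proof.
rewrite -(card_imset _ (imset_inj skip_inj)); apply: eq_card => B.
rewrite !inE; apply/andP/imsetP => [[/orP[/eqP->|/imsetP[C mC ->]]]|[C]].
- by rewrite card_chord.
- by rewrite card_imset => [cC|]; [exists C; rewrite ?inE ?mC | exact: skip_inj].
by rewrite inE => /andP[mC cC] ->; rewrite imset_f ?orbT ?card_imset //; apply: skip_inj.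
Qed.

Lemma insert_chord_matchings_f f m :
  (insert_chord m \in matchings_f N.+2 f) = (m \in matchings_f N f).
Proof. by rewrite inE insert_chord_matchings card_unmatched_insert [RHS]inE. Qed.

(** Every other block is disjoint from [chord], hence lies in the image of [skip] and is recovered
    from its preimage. *)
Lemma insert_chord_onto (m : {set {set 'I_N.+2}}) :
  partition m setT -> chord \in m -> exists m', m = insert_chord m'.
Proof.
move=> part mP; exists [set skip @^-1: (B : {set 'I_N.+2}) | B in m :\ chord].
rewrite /insert_chord -imset_comp -[LHS](setD1K mP); congr (_ |: _).
rewrite -[LHS]imset_id; apply: eq_in_imset => B mB /=.
have sB : B \subset skip @: setT.
  by rewrite skip_setT -setTD; apply: partitionS mB; apply: partitionD1.
apply/setP=> i; apply/idP/imsetP => [Bi|[j]]; last by rewrite inE => ? ->.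
by have /imsetP[j _ ij] := subsetP sB i Bi; exists j; rewrite ?inE -?ij.
Qed.

(** The counterpart of [rise_free_insert]: the new chord is at t, and an old short chord at t - 1
    gets stretched around it, so only positions i with i + 1 < t matter. *)
Lemma avoid_insert_chord (R : pred nat) m :
  [forall i in Short (insert_chord m), ~~ below t R i] =
  [forall i in Short m, ~~ below t.-1 R i].
Proof.
apply/avoidP/avoidP => av u v uv uvm; apply/negP=> /andP[lt_ut Ru].
  have [lt_u lt_v] : u < t /\ v < t by lia.
  have /av/(_ _)/negP : skip v = (skip u).+1 :> nat by rewrite !val_skip lt_u lt_v.
  rewrite /below val_skip lt_u Ru lt_u; apply=> //.
  by apply/setU1P; right; apply/imsetP; exists [set u; v] => //; rewrite imsetU !imset_set1.
have nchord : u \notin chord by rewrite in_chord; lia.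
case/setU1P: uvm => [E|/imsetP[B mB E]]; first by rewrite -E set21 in nchord.
have /imsetP[i Bi ui] : u \in skip @: B by rewrite -E set21.
have /imsetP[j Bj vj] : v \in skip @: B by rewrite -E set22.
have := skip_notin_chord j; rewrite -vj in_chord => vt.
move: (congr1 val ui) (congr1 val vj) => /= ui' vj'; rewrite !val_skip in ui' vj'.
(* Since u < t, v = u + 1 is at most t, and v = t is impossible because v lies off the chord. *)
have [lt_i lt_j] : i < t /\ j < t.
  by move: ui' vj'; case: ltnP => ?; case: ltnP => ?; split=> //; lia.
rewrite lt_i lt_j in ui' vj'.
have /negP[] : ~~ below t.-1 R i; last by rewrite /below -ui' Ru andbT; lia.
apply: (av i j); first by rewrite -ui' -vj'.
by have -> : [set i; j] = B by apply: (imset_inj skip_inj); rewrite imsetU !imset_set1 -ui -vj.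
Qed.

Lemma card_avoiding_deletion f (R : pred nat) : R t ->
  #|avoiding N.+2 f (below t R)| =
    #|avoiding N.+2 f (below t.+1 R)| + #|avoiding N f (below t.-1 R)|.
Proof.
move=> Rt; rewrite -(card_imset (avoiding N f _) insert_chord_inj).
rewrite -[LHS](cardsID (avoiding N.+2 f (below t.+1 R))).
(* Restricting position t as well amounts to excluding [chord], so the matchings lost are those
   obtained by inserting it. *)
have avS m : [forall i in Short m, ~~ below t.+1 R i] =
    (chord \notin m) && [forall i in Short m, ~~ @below t R i].
  apply/avoidP/andP => [av|[nm /avoidP av] u v uv uvm].
    split; last first.
      by apply/avoidP => u v uv /(av u v uv); apply: contra => /andP[/leqW lt_u ?]; apply/andP.
    apply/negP => /av; rewrite /below !inordK ?ltnS ?leqW //.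
    by rewrite leqnn Rt => /(_ erefl).
  apply/negP => /andP[]; rewrite ltnS leq_eqVlt => /orP[/eqP ut _|lt_ut Ru].
    case/negP: nm; rewrite /chord -ut -uv !inord_val //.
  by have := av u v uv uvm; rewrite /below lt_ut Ru.
congr (_ + _); apply: eq_card => m.
  by rewrite !inE avS; apply: andb_idl => /andP[-> /andP[_ ->]].
rewrite inE [m \in avoiding _ _ _]inE [m \in avoiding _ _ (below t R)]inE avS.
apply/andP/imsetP => [[nav /andP[mf av]]|[m' m'A ->]].
  move: nav; rewrite mf av andbT /= negbK => mP.
  have [m' mE] : exists m', m = insert_chord m'.
    by apply: insert_chord_onto mP; move: mf; rewrite !inE => /andP[/andP[]].
  exists m' => //; move: mf av.
  by rewrite mE avoid_insert_chord insert_chord_matchings_f [_ \in avoiding _ _ _]inE => -> ->.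
move: m'A; rewrite inE => /andP[mf av].
by rewrite insert_chord_matchings_f avoid_insert_chord mf av setU11.
Qed.

End InsertChord.
Lemma eq_avoiding N f (R R' : pred nat) :
  (forall i, i.+1 < N -> R i = R' i) -> avoiding N f R = avoiding N f R'.
Proof.
move=> eqR; apply/setP=> m; rewrite !inE; congr (_ && _).
by apply/avoidP/avoidP => av u v uv /(av u v uv); rewrite eqR // -uv.
Qed.

Lemma avoiding_predT N f :
  avoiding N f predT = [set m in matchings_f N f | Short m == set0].
Proof.
apply/setP=> m; rewrite !inE; congr (_ && _).
apply/forall_inP/eqP => [no|->] => [|i]; last by rewrite inE.
by apply/setP=> i; rewrite in_set0; apply/negP => /no.
Qed.

(** A chord besides the f singletons would give more than f nonempty blocks on f points. *)
Lemma matchings_f_chordless f (m : {set {set 'I_f}}) u v :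
  m \in matchings_f f f -> u != v -> [set u; v] \notin m.
Proof.
rewrite inE => /andP[]; rewrite inE => /andP[/card_partition part /forall_inP szs] /eqP cu neq_uv.
apply/negP=> uvm; suff : f < #|m|.
  rewrite ltnNge => /negP[]; rewrite -[X in _ <= X]card_ord -cardsT part -sum1_card.
  by apply: leq_sum => B /szs /orP[] /eqP->.
rewrite -[X in X < _]cu; apply: proper_card; apply/properP; split.
  by apply/subsetP=> B; rewrite inE => /andP[].
by exists [set u; v]; rewrite // inE cards2 neq_uv andbF.
Qed.

Lemma avoiding_recursive f :
  deletion_recursive f (fun j R => #|avoiding (j.*2 + f) f R|).
Proof.
split=> [R|j R R' eqR|j t R Rt lt_t].
- rewrite double0 add0n; apply: eq_card => m; rewrite inE [RHS]inE.
  case mf: (m \in matchings_f f f); rewrite // !andTb.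
  have chordless (u v : 'I_f) : v = u.+1 :> nat -> [set u; v] \notin m.
    by move=> uv; apply: matchings_f_chordless => //; rewrite -val_eqE /= uv; lia.
  by apply/avoidP/avoidP => _ u v /chordless/negbTE->.
- by rewrite (eq_avoiding _ eqR).
by rewrite doubleS !addSn card_avoiding_deletion //; lia.
Qed.

(** Each summand is a constant multiple of a solution of the recursion. When every position is
    restricted only d = j survives, as the ballot count vanishes unless j - d = 0; so the
    coefficients must be the numbers of matchings without short chords. *)
Lemma card_avoiding f j R :
  #|avoiding (j.*2 + f) f R| =
    \sum_(d < j.+1) #|avoiding (d.*2 + f) f predT| * shifted_words (ballot 0) f d j R.
Proof.
have rec d := shifted_words_recursive f d (ballot_insert_rise 0).
apply: (deletion_recursive_eq (avoiding_recursive f) (G := fun j R => \sum_(d < j.+1)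
  #|avoiding (d.*2 + f) f predT| * shifted_words (ballot 0) f d j R)) => [|{}j].
  split=> [S|i S S' eqS|i t S St lt_t].
  - by rewrite !big_ord1; have [-> _ _] := rec 0.
  - by apply: eq_bigr => d _; have [_ loc _] := rec d; rewrite (loc _ _ _ eqS).
  transitivity (\sum_(d < i.+2) #|avoiding (d.*2 + f) f predT| *
    (shifted_words (ballot 0) f d i.+1 (below t.+1 S) +
     shifted_words (ballot 0) f d i (below t.-1 S))).
    by apply: eq_bigr => d _; have [_ _ del] := rec d; rewrite del.
  under eq_bigr do rewrite mulnDr.
  rewrite big_split /=; congr (_ + _).
  (* The sums differ by the term d = i + 1, which is 0 since there d > i. *)
  by rewrite big_ord_recr /= [shifted_words _ _ i.+1]/shifted_words ltnn muln0 addn0.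
rewrite big_ord_recr /= /shifted_words leqnn subnn card_words_ballot_predT muln1.
rewrite big1 // => d _; rewrite card_words_ballot_predT ltnW // subn_eq0 leqNgt ltn_ord.
by rewrite muln0.
Qed.

(** * Coefficients of the series *)

(** Only the sorted arrangement of x can contribute, and it does so when it has no tie at a position
    of J. *)
Lemma fundamental_coef N (J : {set 'I_N.-1}) (x : {mset nat}%mset) : size x = N ->
  fundamental J x = ([forall j in J, ~~ ties (sort leq x) (val j)] : nat)%:R%R.
Proof.
move=> szx; rewrite /fundamental /word_series; congr (_%:R)%R; set s := sort leq x.
have srt : sorted leq s by apply: sort_sorted; apply: leq_total.
have asc (j : 'I_N.-1) : (nth 0 s j < nth 0 s j.+1) = ~~ ties s j.
  rewrite ltn_neqAle /ties; move/(sortedP 0): srt => -> //; first by rewrite andbT.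
  by rewrite size_sort szx; have := ltn_ord j; lia.
have sP : s \in permutations x by rewrite mem_permutations perm_sort.
rewrite (eq_in_count (a2 := fun w => (w == s) && [forall j in J, ~~ ties s (val j)])) => [|w].
  case: forallP => _; last by rewrite (eq_count (a2 := pred0)) ?count_pred0 // => w; rewrite andbF.
  rewrite (eq_count (a2 := pred1 s)) => [|w]; last by rewrite andbT.
  by rewrite count_uniq_mem ?permutations_uniq // sP.
rewrite mem_permutations => pw; case: (eqVneq w s) => [->|neq_ws] /=.
  rewrite size_sort szx eqxx srt /=; apply: eq_forallb => j.
  by rewrite -asc.
apply/negP => /and3P[_ sw _]; case/eqP: neq_ws.
by apply: (sorted_eq leq_trans anti_leq) => //; rewrite perm_sym perm_sort perm_sym.
Qed.

Lemma fundamental_degree N (J : {set 'I_N.-1}) (x : {mset nat}%mset) :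
  size x != N -> fundamental J x = 0%R.
Proof.
move=> szx; rewrite /fundamental /word_series (eq_in_count (a2 := pred0)) ?count_pred0 // => w.
by rewrite mem_permutations => /perm_size /= ->; rewrite (negbTE szx).
Qed.

Lemma quasi_gen_Short N f (x : {mset nat}%mset) : size x = N ->
  quasi_gen (@Short N) (matchings_f N f) x = #|avoiding N f (ties (sort leq x))|%:R%R.
Proof.
move=> szx; rewrite /quasi_gen /series_sum -sum1_card GRing.natr_sum.
rewrite (eq_bigl (fun m => (m \in matchings_f N f) &&
  [forall j in Short m, ~~ ties (sort leq x) (val j)])) => [|m]; last by rewrite inE.
rewrite [RHS]big_mkcondr; apply: eq_bigr => m _; rewrite fundamental_coef //.
by case: ifP.
Qed.

(** * Symmetry of two-row Schur functions *)

(** For x of size N at least a, the number of such arrangements is the coefficient of x in h_a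
    h_(N-a). *)
Definition sorted_rows a (w : seq nat) : bool :=
  sorted leq (take a w) && sorted leq (drop a w).

(** Renaming the letters and sorting each row again is injective, since a sorted row is determined
    by its content. The inverse renaming supplies the opposite inequality later. *)
Lemma leq_count_rename (sigma : nat -> nat) a (x y : seq nat) : injective sigma ->
  perm_eq y (map sigma x) ->
  count (sorted_rows a) (permutations x) <= count (sorted_rows a) (permutations y).
Proof.
move=> inj pxy; rewrite -!size_filter.
pose F w := sort leq (map sigma (take a w)) ++ sort leq (map sigma (drop a w)).
have [takeF dropF] : (forall w, take a (F w) = sort leq (map sigma (take a w))) /\
    (forall w, drop a (F w) = sort leq (map sigma (drop a w))).
  split=> w; rewrite /F; have [le_a|/ltnW lt_a] := leqP a (size w).
  - by rewrite take_size_cat // size_sort size_map size_takel.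
  - by rewrite (drop_oversize lt_a) cats0 take_oversize // size_sort size_map take_oversize.
  - by rewrite drop_size_cat // size_sort size_map size_takel.
  by rewrite (drop_oversize lt_a) cats0 drop_oversize // size_sort size_map take_oversize.
rewrite -(size_map F); apply: uniq_leq_size.
  rewrite map_inj_in_uniq ?filter_uniq ?permutations_uniq // => w w'.
  rewrite !mem_filter => /andP[/andP[s1 s2] _] /andP[/andP[s1' s2'] _] E.
  have eq_row r r' : sorted leq r -> sorted leq r' ->
      sort leq (map sigma r) = sort leq (map sigma r') -> r = r'.
    move=> sr sr' /(perm_sortP leq_total leq_trans anti_leq) pr.
    by apply: (sorted_eq leq_trans anti_leq) => //; apply: perm_map_inj pr.
  rewrite -(cat_take_drop a w) -(cat_take_drop a w'); congr (_ ++ _); apply: eq_row => //.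
    by rewrite -!takeF E.
  by rewrite -!dropF E.
move=> _ /mapP[w + ->]; rewrite !mem_filter !mem_permutations => /andP[_ pw].
rewrite /sorted_rows takeF dropF !sort_sorted; try exact: leq_total.
rewrite /= (permPr pxy) -(permPr (perm_map sigma pw)) -[in X in perm_eq _ X](cat_take_drop a w).
by rewrite map_cat perm_cat // perm_sort.
Qed.

(** By [card_words_ballot] the coefficient is a difference of two counts of pairs of rows, each
    invariant under renaming. *)
Lemma schur_two_row_rename N k (sigma : nat -> nat) (x : {mset nat}%mset) :
  k.*2 <= N -> bijective sigma ->
  schur [:: N - k; k] (rename_vars sigma x) = schur [:: N - k; k] x.
Proof.
move=> le_kN [tau sigmaK tauK]; set y := rename_vars sigma x.
have pxy : perm_eq y (map sigma x) by apply: perm_eq_seq_mset.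
have szy : size y = size x by rewrite (perm_size pxy) size_map.
have [szx|neq] := eqVneq (size x) N; last first.
  have szx : size x != sumn [:: N - k; k] by rewrite /= addn0 subnK //; lia.
  by rewrite !schur_degree ?szy.
rewrite !schur_two_row ?szy //; congr (_%:R)%R.
have pyx : perm_eq x (map tau y).
  rewrite perm_sym; apply: perm_trans (perm_map tau pxy) _.
  by rewrite -map_comp (eq_map sigmaK) map_id.
have eq_words_rename i : i <= N ->
    #|words predT N i (ties (sort leq y))| = #|words predT N i (ties (sort leq x))|.
  have E z : i <= N -> size z = N ->
      count (sorted_rows (N - i)) (permutations z) = #|words predT N i (ties (sort leq z))|.
    move=> le_i szz; rewrite -(@count_two_rows predT predT) //.
    by apply: eq_count => w; rewrite andbT.
  move=> le_i; rewrite -!E ?szy //; apply/eqP; rewrite eqn_leq.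
  by rewrite (leq_count_rename _ (can_inj sigmaK) pxy) (leq_count_rename _ (can_inj tauK) pyx).
(* The choice e = N - 2k, j = k gives words of length N. *)
have := card_words_ballot (N - k.*2) k; rewrite /shifted_words subnKC // subn0 => B.
have [le_k le_k1] : k <= N /\ k - 1 <= N by lia.
move: (B (ties (sort leq y))); rewrite !eq_words_rename // -(B (ties (sort leq x))) /=.
by move/eqP; rewrite eqn_add2r => /eqP.
Qed.

Lemma schur_pad_zeros a b m x : schur [:: a, b & nseq m 0] x = schur [:: a; b] x.
Proof.
have E w : reshape (nseq m 0) w = nseq m [::].
  by elim: m w => //= m IH w; rewrite take0 drop0 IH.
rewrite /schur /word_series; congr (_%:R)%R; apply: eq_count => w.
rewrite /= sumn_nseq mul0n /semistandard /= E; congr (_ && (_ && _)).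
  by rewrite all_nseq orbT.
congr (_ && _); elim: m {E} (take b _) => //= m IH r; rewrite IH andbT.
by case: r.
Qed.

(** * Expansion over partitions and conclusion *)

Lemma exists_two_row_partn N k : 1 < N -> k.*2 <= N ->
  exists la : Defs.partn N, parts la = [:: N - k, k & nseq (N - 2) 0].
Proof.
move=> N_gt1 le_kN; pose l := [:: N - k, k & nseq (N - 2) 0].
have szl : size (map (@inord N) l) == N by rewrite size_map /= size_nseq; lia.
have vall : [seq val i | i <- Tuple szl] = l.
  rewrite -map_comp -[RHS]map_id; apply/eq_in_map => i il /=; rewrite inordK // ltnS.
  by move: il; rewrite !inE mem_nseq => /or3P[/eqP->|/eqP->|/andP[_ /eqP->]]; lia.
have la_part : is_partn (Tuple szl).
  rewrite /is_partn vall /= sumn_nseq mul0n addn0 subnK ?eqxx ?andbT; last lia.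
  have -> : path geq k (nseq (N - 2) 0).
    by case: (N - 2) => //= m; elim: m => //= m ->.
  by rewrite andbT /=; lia.
by exists (Sub (Tuple szl) la_part).
Qed.

Theorem theorem1p6 (n f N : nat) (hn : 0 < n) (hN : N = 2 * n + f) :
  schur_positive (@Short N) (matchings_f N f) /\
  quasi_gen (@Short N) (matchings_f N f) =1
    series_sum predT (fun k : 'I_n.+1 =>
      series_scale
        #|[set m in matchings_f (N - 2 * k) f | Short m == set0]|%:R%R
        (schur [:: N - k; val k])).
Proof.
have hN2 : N = n.*2 + f by rewrite hN mul2n.
have le_kN (k : 'I_n.+1) : k.*2 <= N by have := ltn_ord k; lia.
set c := fun k : 'I_n.+1 => #|[set m in matchings_f (N - 2 * k) f | Short m == set0]|.
have expansion : quasi_gen (@Short N) (matchings_f N f) =1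
    series_sum predT (fun k : 'I_n.+1 => series_scale (c k)%:R%R (schur [:: N - k; val k])).
  move=> x; rewrite /series_sum /series_scale; have [szx|neq] := eqVneq (size x) N; last first.
    rewrite /quasi_gen /series_sum big1 => [|m _]; last by rewrite fundamental_degree.
    rewrite big1 // => k _; rewrite schur_degree ?GRing.mulr0 //=.
    by rewrite addn0 subnK //; have := le_kN k; lia.
  have := card_avoiding f n (ties (sort leq x)); rewrite -hN2 quasi_gen_Short // => ->.
  rewrite GRing.natr_sum.
  (* In [card_avoiding] the index d is half the number of matched points of the smaller matching;
     the theorem uses k = n - d. *)
  rewrite (reindex_inj rev_ord_inj); apply: eq_bigr => k _ /=.
  rewrite schur_two_row // -GRing.natrM; congr (_%:R)%R.
  have lt_k := ltn_ord k; rewrite /shifted_words subSS leq_subr subKn // -hN2 /c -avoiding_predT.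
  by have -> : (n - k).*2 + f = N - 2 * k by lia.
split=> //; split; last first.
  have [la laE] : exists la : 'I_n.+1 -> Defs.partn N,
      forall k, parts (la k) = [:: N - k, val k & nseq (N - 2) 0].
    by apply: (fin_all_exists (P := fun k la => parts la = _)) => k;
       apply: exists_two_row_partn => //; lia.
  (* Summing indicators of [mu == la k] spares a proof that [la] is injective. *)
  exists (fun mu => \sum_k (mu == la k)%:R * (c k)%:R)%R; split=> [x|mu]; last first.
    by apply: GRing.rpred_sum => k _; rewrite -GRing.natrM Num.Theory.natr_nat.
  rewrite expansion /series_sum /series_scale.
  under [RHS]eq_bigr do rewrite GRing.mulr_suml.
  rewrite exchange_big /=; apply: eq_bigr => k _.
  rewrite (bigD1 (la k)) //= eqxx GRing.mul1r laE schur_pad_zeros big1 ?GRing.addr0 // => mu.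
  by move=> /negbTE->; rewrite !GRing.mul0r.
split=> [|sigma bij x].
  exists N => x; apply: contraR; rewrite -ltnNge => lt_N.
  rewrite /quasi_gen /series_sum big1 // => m _; rewrite fundamental_degree //.
  by rewrite gtn_eqF.
(* Symmetry is inherited term by term from the Schur functions. *)
rewrite !expansion; apply: eq_bigr => k _; congr (_ * _)%R.
by apply: schur_two_row_rename.
Qed.
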